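(* Consider the harmonic oscillator with eigenfrequency $\omega_s>0$ and Lagrangian $L(q,\dot q)=\tfrac12\dot q^2-\tfrac12\omega_s^2q^2$, $q\in\mathbb{R}$. Let $p\in\mathbb{N}$, $\Delta T=p\,\Delta t>0$, $\alpha_V\in[0,1]$, and interpolate $q$ linearly between macro nodes. (1) With the trapezoidal rule (parameter $\alpha_V$) used on the micro grid to approximate the action, the algorithm is linearly stable if $$\omega_s^2\Delta T^2<\frac{12p^2}{p^2+2}.$$ For $p=1$ the upper bound is $4$, and the supremum over $p$ of the upper bound is $12$. (2) With the midpoint rule used on the micro grid to approximate the action, the algorithm is linearly stable if $$\omega_s^2\Delta T^2<\frac{12p^2}{p^2-1}.$$ For $p=1$ the scheme is unconditionally stable (it is the midpoint rule). For $p\to\infty$, the infimum of the upper bound is $12$.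
   Context: Here $p$ (without index) is the number of micro steps per macro step and $p_k$ denotes the momentum at macro node $k\Delta T$. The interpolated values at the micro nodes are $q_k^m=q_k+\frac mp(q_{k+1}-q_k)$, $m=0,\dots,p$, and $\bar q_k^m=\frac12(q_k^m+q_k^{m+1})$. The trapezoidal algorithm is the (implicit, linear) one-step map $(q_k,p_k)\mapsto(q_{k+1},p_{k+1})$ given by $$q_{k+1}=q_k+\Delta T\Big[p_k-\Delta t\,\omega_s^2\Big(\sum_{m=1}^{p-1}\frac{p-m}{p}q_k^m+\alpha_Vq_k^0\Big)\Big],$$ $$p_{k+1}=p_k-\Delta t\,\omega_s^2\Big(\sum_{m=1}^{p-1}q_k^m+\alpha_Vq_k^0+(1-\alpha_V)q_k^p\Big).$$ The midpoint algorithm is the one-step map given by $$q_{k+1}=q_k+\frac{\Delta T}{2}\Big(p_k+p_{k+1}-\Delta t\,\omega_s^2\sum_{m=0}^{p-1}\Big(1-\frac{2m+1}{p}\Big)\bar q_k^m\Big),$$ $$p_{k+1}=p_k-\Delta t\,\omega_s^2\sum_{m=0}^{p-1}\bar q_k^m.$$ Each can be written as $(q_{k+1},p_{k+1})^T=P\,(q_k,p_k)^T$ with a $2\times2$ propagation matrix $P$. The algorithm is linearly stable if the eigenvalues of $P$ are distinct and of modulus one. *)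

(* Defs.v *)
From mathcomp Require Import all_boot all_order all_algebra.
From mathcomp Require Import all_classical all_reals all_analysis.
From mathcomp Require Import complex.

Set Implicit Arguments.
Unset Strict Implicit.
Unset Printing Implicit Defensive.

Import Order.TTheory GRing.Theory Num.Theory.
Import numFieldNormedType.Exports.

Local Open Scope classical_set_scope.
Local Open Scope ring_scope.
Local Open Scope complex_scope.

Section Algorithms.
Variable R : realType.
Implicit Types (p m : nat) (q mom w dT dt alpha : R).

(* Here q, q' are the positions q_k, q_{k+1} and mom, mom' are the momenta
   p_k, p_{k+1}; p is the number of micro steps per macro step. *)

Definition micro_node p q q' m : R := q + m%:R / p%:R * (q' - q).

Definition micro_midpoint p q q' m : R :=
  (micro_node p q q' m + micro_node p q q' m.+1) / 2.

(* Both algorithms are implicit, so a step is a relation between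
   (q_k, p_k) and (q_{k+1}, p_{k+1}). *)
Definition trapezoidal_step p w dT dt alpha q mom q' mom' : Prop :=
  q' = q + dT * (mom - dt * w ^+ 2 *
         (\sum_(1 <= m < p) (p%:R - m%:R) / p%:R * micro_node p q q' m
          + alpha * micro_node p q q' 0))
  /\ mom' = mom - dt * w ^+ 2 *
         (\sum_(1 <= m < p) micro_node p q q' m
          + alpha * micro_node p q q' 0
          + (1 - alpha) * micro_node p q q' p).

Definition midpoint_step p w dT dt q mom q' mom' : Prop :=
  q' = q + dT / 2 * (mom + mom' - dt * w ^+ 2 *
         \sum_(0 <= m < p)
            (1 - (2 * m%:R + 1) / p%:R) * micro_midpoint p q q' m)
  /\ mom' = mom - dt * w ^+ 2 * \sum_(0 <= m < p) micro_midpoint p q q' m.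

Definition phase q mom : 'cV[R]_2 :=
  \col_(i < 2) (if i == ord0 then q else mom).

(* The equivalence says both that the implicit equations are uniquely solvable
   and that the resulting one-step map is multiplication by P. *)
Definition propagation_matrix (step : R -> R -> R -> R -> Prop)
    (P : 'M[R]_2) : Prop :=
  forall q mom q' mom',
    step q mom q' mom' <-> phase q' mom' = P *m phase q mom.

Definition linearly_stable (step : R -> R -> R -> R -> Prop) : Prop :=
  exists P : 'M[R]_2, propagation_matrix step P /\
  exists l1 l2 : R[i],
    [/\ l1 != l2,
        forall z : R[i],
          eigenvalue (map_mx (real_complex R) P) z <-> z = l1 \/ z = l2,
        `|l1| = 1 & `|l2| = 1].

Definition implicit_midpoint_rule (f : 'cV[R]_2 -> 'cV[R]_2) (h : R)
    (z z' : 'cV[R]_2) : Prop :=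
  z' = z + h *: f (2^-1 *: (z + z')).

(* Hamilton's equations of the Lagrangian v^2 / 2 - w^2 q^2 / 2:
   dq/dt = mom, dmom/dt = - w^2 q. *)
Definition oscillator_field w (z : 'cV[R]_2) : 'cV[R]_2 :=
  phase (z ord_max ord0) (- w ^+ 2 * z ord0 ord0).

Definition trapezoidal_bound p : R := 12 * p%:R ^+ 2 / (p%:R ^+ 2 + 2).

(* Meaningful for 1 < p only: at p = 1 the denominator vanishes, and x / 0 = 0
   whereas the intended bound is infinite. *)
Definition midpoint_bound p : R := 12 * p%:R ^+ 2 / (p%:R ^+ 2 - 1).

End Algorithms.

(* Main.v *)
(* Summing the interpolated values in closed form turns both algorithms into
     D q' = (D - x a) q + h mom,
     mom' = mom - h w^2 (a q + (1 - a) q'),     h = dT,  x = w^2 h^2,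
   with D = 1 + x (p^2 - 1) / (6 p^2) for the trapezoidal rule and
   D = 1 + x / 4 - x (p^2 - 1) / (12 p^2) for the midpoint rule. The propagation
   matrix has determinant 1 (the scheme is symplectic) and trace 2 - x / D, so
   its eigenvalues are distinct and of modulus one as soon as 0 < x < 4 D, which
   is the stated bound. *)
Require Import Defs.
From mathcomp Require Import all_boot all_order all_algebra.
From mathcomp Require Import all_classical all_reals all_analysis.
From mathcomp Require Import complex ring lra.

Import Order.TTheory GRing.Theory Num.Theory.
Import numFieldNormedType.Exports.

Local Open Scope classical_set_scope.
Local Open Scope ring_scope.

(** * Spectrum of 2 x 2 matrices *)

Lemma det_mx2 (R : comNzRingType) (A : 'M[R]_2) :
  \det A = A ord0 ord0 * A ord_max ord_max - A ord0 ord_max * A ord_max ord0.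
Proof.
rewrite (expand_det_row _ ord0) big_ord_recl big_ord1 /cofactor !det_mx11 !mxE.
have -> : lift ord0 ord0 = ord_max :> 'I_2 by exact: val_inj.
have -> : lift ord_max ord0 = ord0 :> 'I_2 by exact: val_inj.
by rewrite /= expr0 expr1; ring.
Qed.

Lemma mxtrace_mx2 (R : nmodType) (A : 'M[R]_2) :
  \tr A = A ord0 ord0 + A ord_max ord_max.
Proof.
rewrite /mxtrace big_ord_recr big_ord1 /=.
by congr (A _ _ + _); apply: val_inj.
Qed.

Lemma eigenvalue_mx2 (F : fieldType) (A : 'M[F]_2) (z : F) :
  eigenvalue A z = (z ^+ 2 - \tr A * z + \det A == 0).
Proof.
rewrite eigenvalue_root_char rootE horner_coef size_char_poly.
rewrite !big_ord_recr big_ord0 /= char_poly_det (char_poly_trace (n := 2)) //.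
have /monicP := char_poly_monic A; rewrite /lead_coef size_char_poly /= => ->.
by congr (_ == 0); ring.
Qed.

(** The characteristic polynomial z^2 - (tr P) z + 1 has negative discriminant, so its roots are the
    conjugates t + i s and t - i s with t = tr P / 2 and s > 0. Their product t^2 + s^2 = 1 is both
    the determinant and the squared modulus. *)
Lemma elliptic_eigenvalues (R : realType) (P : 'M[R]_2) :
  \det P = 1 -> `|\tr P| < 2 ->
  exists l1 l2 : R[i],
    [/\ l1 != l2,
        forall z : R[i],
          eigenvalue (map_mx (real_complex R) P) z <-> z = l1 \/ z = l2,
        `|l1| = 1 & `|l2| = 1].
Proof.
move=> detP; rewrite ltr_norml => /andP[trP_gt trP_lt].
set t := \tr P / 2; set s := Num.sqrt (1 - t ^+ 2).
have t2 : 0 < 1 - t ^+ 2 by rewrite /t; nra.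
have s_gt0 : 0 < s by rewrite sqrtr_gt0.
have s2 : s ^+ 2 = 1 - t ^+ 2 by rewrite sqr_sqrtr// ltW.
exists (Complex t s), (Complex t (- s)); split.
- by rewrite eq_complex /= eqxx /= -subr_eq0 opprK; apply/eqP; lra.
- move=> z; rewrite eigenvalue_mx2 det_map_mx trace_map_mx detP.
  have -> : z ^+ 2 - real_complex R (\tr P) * z + real_complex R 1 =
      (z - Complex t s) * (z - Complex t (- s)).
    have -> : real_complex R (\tr P) = Complex t s + Complex t (- s).
      apply/eqP; rewrite eq_complex /= subrr eqxx andbT.
      by apply/eqP; rewrite /t; lra.
    have -> : real_complex R 1 = Complex t s * Complex t (- s).
      apply/eqP; rewrite eq_complex /=; apply/andP; split; apply/eqP; last ring.
      by rewrite mulrN opprK -!expr2 s2 subrKC.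
    by ring.
  rewrite mulf_eq0 !subr_eq0; split.
    by case/orP => /eqP ->; [left|right].
  by case=> ->; rewrite eqxx ?orbT.
- by rewrite normc_def /= s2 subrKC sqrtr1.
- by rewrite normc_def /= sqrrN s2 subrKC sqrtr1.
Qed.

(** * Stability of the common form of both algorithms *)

Definition mx2 {R : Type} (a b c d : R) : 'M[R]_2 :=
  \matrix_(i, j) if i == ord0 then (if j == ord0 then a else b)
                 else (if j == ord0 then c else d).

Lemma phaseP (R : realType) (q mom : R) (v : 'cV[R]_2) :
  phase q mom = v <-> q = v ord0 ord0 /\ mom = v ord_max ord0.
Proof.
split=> [<-|[-> ->]]; first by rewrite !mxE.
apply/colP => i; rewrite !mxE; case: eqP => [->//|/eqP i_neq0].
by congr (v _ _); apply: val_inj; case: i i_neq0 => [[|[]]].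
Qed.

Lemma mx2_phase (R : realType) (a b c d q mom : R) :
  mx2 a b c d *m phase q mom = phase (a * q + b * mom) (c * q + d * mom).
Proof.
by apply/esym/phaseP; rewrite !mxE !big_ord_recl !big_ord0 !mxE /= !addr0.
Qed.

Lemma linearly_stable_step (R : realType) (step : R -> R -> R -> R -> Prop)
    (D a W h : R) :
  (forall q mom q' mom', step q mom q' mom' <->
     D * q' = (D - W * h ^+ 2 * a) * q + h * mom
     /\ mom' = mom - h * W * (a * q + (1 - a) * q')) ->
  0 < W * h ^+ 2 < 4 * D -> linearly_stable step.
Proof.
move=> stepE /andP[x_gt0 x_lt].
(* The window 0 < x < 4 D forces D > 0, which makes the implicit equation uniquely solvable for
   [q']. *)
have D_gt0 : 0 < D by lra.
have D_neq0 : D != 0 by rewrite gt_eqF.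
set x := W * h ^+ 2 in x_gt0 x_lt *.
(* The first row solves the position equation for [q']; the second substitutes this [q'] into the
   momentum equation. *)
exists (mx2 ((D - x * a) / D) (h / D)
  (- (h * W) * (a + (1 - a) * ((D - x * a) / D))) (1 - x * (1 - a) / D)).
split.
  move=> q mom q' mom'; rewrite mx2_phase phaseP !mxE /=.
  apply: (iff_trans (stepE q mom q' mom')); rewrite -/x.
  have q'E : D * q' = (D - x * a) * q + h * mom <->
      q' = (D - x * a) / D * q + h / D * mom.
    split=> [eq_q'|->]; last by field.
    by apply: (mulfI D_neq0); rewrite eq_q'; field.
  split=> -[eq_q' ->].
    by move/q'E: eq_q' => eq_q'; split=> //; rewrite eq_q' /x; field.
  by split; [apply/q'E|rewrite eq_q' /x; field].
apply: elliptic_eigenvalues.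
  by rewrite det_mx2 !mxE /= /x; field.
rewrite mxtrace_mx2 !mxE /=.
have -> : (D - x * a) / D + (1 - x * (1 - a) / D) = 2 - x / D by field.
have xD_gt0 : 0 < x / D by exact: divr_gt0.
have xD_lt4 : x / D < 4 by rewrite ltr_pdivrMr.
by rewrite ltr_norml; lra.
Qed.

(** * Closed forms of the sums over the micro grid *)

(** Linear interpolation against weights affine in m gives summands of degree at most two in m, so
    this formula evaluates all four sums below. *)
Lemma sum_quadratic (R : numFieldType) (a b c : R) (n : nat) :
  \sum_(0 <= m < n) (a + b * m%:R + c * m%:R ^+ 2) =
  a * n%:R + b * (n%:R * (n%:R - 1) / 2)
  + c * (n%:R * (n%:R - 1) * (2 * n%:R - 1) / 6).
Proof.
elim: n => [|n IHn]; first by rewrite big_nil; ring.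
by rewrite big_nat_recr //= IHn -natr1; field.
Qed.

Lemma trapezoidal_sum (R : realType) (p : nat) (q q' : R) : (0 < p)%N ->
  \sum_(1 <= m < p) micro_node p q q' m =
  (p%:R - 1) / 2 * q + (p%:R - 1) / 2 * q'.
Proof.
move=> p_gt0; have p_neq0 : p%:R != 0 :> R by rewrite pnatr_eq0 -lt0n.
(* Adding the term m = 0 to both sides makes the sum start at 0, as [sum_quadratic] requires. *)
apply: (addrI (micro_node p q q' 0)); rewrite -[LHS]big_ltn //.
rewrite (eq_bigr (fun m => q + (q' - q) / p%:R * m%:R + 0 * m%:R ^+ 2)).
  by rewrite sum_quadratic /micro_node; field.
by move=> m _; rewrite /micro_node; field.
Qed.

Lemma trapezoidal_weighted_sum (R : realType) (p : nat) (q q' : R) :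
  (0 < p)%N ->
  \sum_(1 <= m < p) (p%:R - m%:R) / p%:R * micro_node p q q' m =
  (p%:R - 1) / 2 * q + (p%:R ^+ 2 - 1) / (6 * p%:R) * (q' - q).
Proof.
move=> p_gt0; have p_neq0 : p%:R != 0 :> R by rewrite pnatr_eq0 -lt0n.
pose F m := (p%:R - m%:R) / p%:R * micro_node p q q' m.
apply: (addrI (F 0)); rewrite -[LHS]big_ltn // /F.
rewrite (eq_bigr (fun m => q + ((q' - q) - q) / p%:R * m%:R
                           + - ((q' - q) / p%:R ^+ 2) * m%:R ^+ 2)).
  by rewrite sum_quadratic /micro_node; field.
by move=> m _; rewrite /micro_node; field.
Qed.

Lemma midpoint_sum (R : realType) (p : nat) (q q' : R) : (0 < p)%N ->
  \sum_(0 <= m < p) micro_midpoint p q q' m = p%:R * (q + q') / 2.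
Proof.
move=> p_gt0; have p_neq0 : p%:R != 0 :> R by rewrite pnatr_eq0 -lt0n.
rewrite (eq_bigr (fun m => (q + (q' - q) / (2 * p%:R))
  + (q' - q) / p%:R * m%:R + 0 * m%:R ^+ 2)).
  by rewrite sum_quadratic; field.
by move=> m _; rewrite /micro_midpoint /micro_node -natr1; field.
Qed.

(** The weights change sign under m -> p - 1 - m, so the constant part of the interpolant cancels
    and only the increment [q' - q] survives. *)
Lemma midpoint_weighted_sum (R : realType) (p : nat) (q q' : R) : (0 < p)%N ->
  \sum_(0 <= m < p) (1 - (2 * m%:R + 1) / p%:R) * micro_midpoint p q q' m =
  - ((p%:R ^+ 2 - 1) / (6 * p%:R) * (q' - q)).
Proof.
move=> p_gt0; have p_neq0 : p%:R != 0 :> R by rewrite pnatr_eq0 -lt0n.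
pose d := (q' - q) / p%:R; pose r := (p%:R)^-1 : R.
rewrite (eq_bigr (fun m => (1 - r) * (q + d / 2)
  + ((1 - r) * d - 2 * r * (q + d / 2)) * m%:R + - (2 * r * d) * m%:R ^+ 2)).
  by rewrite sum_quadratic /d /r; field.
by move=> m _; rewrite /micro_midpoint /micro_node /d /r -natr1; field.
Qed.

(** * Reduction of both algorithms to the common form *)

(** Equations with the same residual are interchangeable; this turns each rearrangement below into
    one [field] identity. *)
Lemma eq_subr_eq (V : zmodType) (a b c d : V) : a - b = c - d -> a = b -> c = d.
Proof.
by move=> eq_sub eq_ab; apply/eqP; rewrite -subr_eq0 -eq_sub eq_ab subrr.
Qed.

(** The parameter [alpha] enters only through [a], which explains why the stability bound does not
    depend on it. *)
Lemma trapezoidal_stepE (R : realType) (p : nat)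
    (w dT dt alpha q mom q' mom' : R) :
  (0 < p)%N -> dT = p%:R * dt ->
  let x := w ^+ 2 * dT ^+ 2 in
  let a := ((p%:R - 1) / 2 + alpha) / p%:R in
  let D := 1 + x * (p%:R ^+ 2 - 1) / (6 * p%:R ^+ 2) in
  trapezoidal_step p w dT dt alpha q mom q' mom' <->
  D * q' = (D - x * a) * q + dT * mom
  /\ mom' = mom - dT * w ^+ 2 * (a * q + (1 - a) * q').
Proof.
move=> p_gt0 -> x a D; have p_neq0 : p%:R != 0 :> R by rewrite pnatr_eq0 -lt0n.
rewrite /trapezoidal_step trapezoidal_sum // trapezoidal_weighted_sum //.
rewrite /micro_node divff // !mul1r mul0r mul0r addr0 subrKC.
split=> -[eq_q' ->]; (split; last by rewrite /a; field).
  by apply: eq_subr_eq eq_q'; rewrite /D /x /a; field.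
by apply: eq_subr_eq eq_q'; rewrite /D /x /a; field.
Qed.

(** Symmetry of the rule gives a = 1/2. Eliminating [mom'] from the position equation produces the
    term x / 4 of [D]. *)
Lemma midpoint_stepE (R : realType) (p : nat) (w dT dt q mom q' mom' : R) :
  (0 < p)%N -> dT = p%:R * dt ->
  let x := w ^+ 2 * dT ^+ 2 in
  let D := 1 + x / 4 - x * (p%:R ^+ 2 - 1) / (12 * p%:R ^+ 2) in
  midpoint_step p w dT dt q mom q' mom' <->
  D * q' = (D - x * 2^-1) * q + dT * mom
  /\ mom' = mom - dT * w ^+ 2 * (2^-1 * q + (1 - 2^-1) * q').
Proof.
move=> p_gt0 -> x D; have p_neq0 : p%:R != 0 :> R by rewrite pnatr_eq0 -lt0n.
rewrite /midpoint_step midpoint_sum // midpoint_weighted_sum //.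
split=> -[eq_q' mom'E]; (split; last by rewrite mom'E; field).
  by apply: eq_subr_eq eq_q'; rewrite mom'E /D /x; field.
by apply: eq_subr_eq eq_q'; rewrite mom'E /D /x; field.
Qed.

(** * Stability bounds of the two algorithms *)

Lemma trapezoidal_stable (R : realType) (p : nat) (w dT dt alpha : R) :
  (0 < p)%N -> 0 < w -> dT = p%:R * dt -> 0 < dT ->
  w ^+ 2 * dT ^+ 2 < trapezoidal_bound R p ->
  linearly_stable (trapezoidal_step p w dT dt alpha).
Proof.
move=> p_gt0 w_gt0 dTE dT_gt0.
have p2_gt0 : 0 < p%:R ^+ 2 :> R by rewrite exprn_gt0 // ltr0n.
have p_neq0 : p%:R != 0 :> R by rewrite pnatr_eq0 -lt0n.
rewrite /trapezoidal_bound ltr_pdivlMr ?addr_gt0 // => x_lt.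
apply: linearly_stable_step.
  by move=> q mom q' mom'; exact: trapezoidal_stepE.
rewrite mulr_gt0 ?exprn_gt0 //=.
(* The gap 4 D - x is the hypothesis cleared of denominators, up to the factor 3 p^2. *)
rewrite -subr_gt0 (_ : _ - _ =
  (12 * p%:R ^+ 2 - w ^+ 2 * dT ^+ 2 * (p%:R ^+ 2 + 2)) / (3 * p%:R ^+ 2)).
  by apply: divr_gt0; [rewrite subr_gt0|rewrite mulr_gt0].
by field.
Qed.

(** The condition is stated without division so as to cover p = 1, where its left side is 0 and it
    always holds. *)
Lemma midpoint_stable (R : realType) (p : nat) (w dT dt : R) :
  (0 < p)%N -> 0 < w -> dT = p%:R * dt -> 0 < dT ->
  w ^+ 2 * dT ^+ 2 * (p%:R ^+ 2 - 1) < 12 * p%:R ^+ 2 ->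
  linearly_stable (midpoint_step p w dT dt).
Proof.
move=> p_gt0 w_gt0 dTE dT_gt0 x_lt.
have p2_gt0 : 0 < p%:R ^+ 2 :> R by rewrite exprn_gt0 // ltr0n.
have p_neq0 : p%:R != 0 :> R by rewrite pnatr_eq0 -lt0n.
apply: linearly_stable_step.
  by move=> q mom q' mom'; exact: midpoint_stepE.
rewrite mulr_gt0 ?exprn_gt0 //=.
rewrite -subr_gt0 (_ : _ - _ =
  (12 * p%:R ^+ 2 - w ^+ 2 * dT ^+ 2 * (p%:R ^+ 2 - 1)) / (3 * p%:R ^+ 2)).
  by apply: divr_gt0; [rewrite subr_gt0|rewrite mulr_gt0].
by field.
Qed.

(** For p = 1 the single weight 1 - 1/1 vanishes and the only midpoint value is (q + q') / 2. *)
Lemma midpoint_step1E (R : realType) (w h q mom q' mom' : R) :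
  midpoint_step 1 w h h q mom q' mom' <->
  implicit_midpoint_rule (oscillator_field w) h (phase q mom) (phase q' mom').
Proof.
rewrite /midpoint_step midpoint_sum // midpoint_weighted_sum //.
rewrite /implicit_midpoint_rule phaseP !mxE /=.
by split=> -[eq_q' eq_mom']; split; lra.
Qed.

(** * Extremal values of the bounds over p *)

(** The limit is an upper bound by hypothesis; conversely almost all terms lie below the supremum,
    hence so does their limit. *)
Lemma sup_of_cvg (R : realType) (u : nat -> R) (l : R) (A : set nat) :
  (\forall n \near \oo, A n) -> (forall n, A n -> u n <= l) ->
  u @ \oo --> l -> sup [set u n | n in A] = l.
Proof.
move=> nearA u_le cvg_u; have ubA : ubound [set u n | n in A] l.
  by move=> _ [n An <-]; exact: u_le.
have [n0 An0] := filter_ex nearA.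
apply/eqP; rewrite eq_le ge_sup //=; last by exists (u n0), n0.
apply: (cvgr_to_le cvg_u); apply: filterS nearA => n An.
by apply: ub_le_sup; [exists l|exists n].
Qed.

Lemma inf_of_cvg (R : realType) (u : nat -> R) (l : R) (A : set nat) :
  (\forall n \near \oo, A n) -> (forall n, A n -> l <= u n) ->
  u @ \oo --> l -> inf [set u n | n in A] = l.
Proof.
move=> nearA u_ge cvg_u; rewrite /inf image_comp.
rewrite (@sup_of_cvg _ _ (- l)) ?opprK // => [n An|].
  by rewrite lerN2 u_ge.
exact: cvgN.
Qed.

(* No condition on c: if n ^+ 2 + c = 0, both sides of the rewriting of the
   sequence are a division by zero, hence 0. *)
Lemma cvg_ratio_bound (R : realType) (c : R) :
  (12 * n%:R ^+ 2 / (n%:R ^+ 2 + c)) @[n --> \oo] --> (12 : R).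
Proof.
(* After the shift the index is nonzero, so the fraction can be divided through by its square;
   [harmonic n] is 1 / (n + 1). *)
rewrite -cvg_shiftS /=.
have -> : (fun n => 12 * n.+1%:R ^+ 2 / (n.+1%:R ^+ 2 + c)) =
    (fun n => 12 / (1 + c * harmonic n ^+ 2)) :> (nat -> R).
  apply/funext => n; rewrite /harmonic /=.
  have n_neq0 : n.+1%:R != 0 :> R by rewrite pnatr_eq0.
  rewrite (_ : 1 + _ = (n.+1%:R ^+ 2 + c) / n.+1%:R ^+ 2); last by field.
  by rewrite invf_div -mulrA.
have cvg_h2 : c * harmonic n ^+ 2 @[n --> \oo] --> c * 0 ^+ 2.
  apply: cvgM; first exact: cvg_cst.
  exact: (cvgM cvg_harmonic cvg_harmonic).
have : 12 / (1 + c * harmonic n ^+ 2) @[n --> \oo] --> 12 / (1 + c * 0 ^+ 2).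
  apply: cvgM; first exact: cvg_cst.
  apply: cvgV; first by rewrite expr0n mulr0 addr0 oner_neq0.
  by apply: cvgD; first exact: cvg_cst.
by rewrite expr0n mulr0 addr0 divr1.
Qed.

Theorem lemma5p1 (R : realType) :
  ((forall (p : nat) (w dT dt alpha : R),
      (0 < p)%N -> 0 < w -> dT = p%:R * dt -> 0 < dT -> 0 <= alpha <= 1 ->
      w ^+ 2 * dT ^+ 2 < trapezoidal_bound R p ->
      linearly_stable (trapezoidal_step p w dT dt alpha))
   /\ trapezoidal_bound R 1 = 4
   /\ sup [set trapezoidal_bound R p | p in [set p : nat | (0 < p)%N]] = 12)
  /\
  ((forall (p : nat) (w dT dt : R),
      (1 < p)%N -> 0 < w -> dT = p%:R * dt -> 0 < dT ->
      w ^+ 2 * dT ^+ 2 < midpoint_bound R p ->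
      linearly_stable (midpoint_step p w dT dt))
   /\ (forall w dT dt : R, 0 < w -> dT = 1%:R * dt -> 0 < dT ->
        linearly_stable (midpoint_step 1 w dT dt)
        /\ (forall q mom q' mom' : R,
              midpoint_step 1 w dT dt q mom q' mom' <->
              implicit_midpoint_rule (oscillator_field w) dT
                (phase q mom) (phase q' mom')))
   /\ inf [set midpoint_bound R p | p in [set p : nat | (1 < p)%N]] = 12
   /\ midpoint_bound R p @[p --> \oo] --> (12 : R)).
Proof.
have sqr_gt1 p : (1 < p)%N -> 0 < p%:R ^+ 2 - 1 :> R.
  by move=> p_gt1; rewrite subr_gt0 exprn_egt1 // ltr1n.
have cvg_midpoint : midpoint_bound R p @[p --> \oo] --> (12 : R).
  by exact: cvg_ratio_bound.
split; [split; last split|split; last split; last split=> //].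
- by move=> p w dT dt alpha p_gt0 w_gt0 dTE dT_gt0 _; exact: trapezoidal_stable.
- by rewrite /trapezoidal_bound; field.
- apply: sup_of_cvg; first exact: nbhs_infty_ge.
    move=> p _; rewrite /trapezoidal_bound.
    have p2_ge0 : 0 <= p%:R ^+ 2 :> R by exact: exprn_ge0.
    by rewrite ler_pdivrMr; lra.
  by exact: cvg_ratio_bound.
- move=> p w dT dt p_gt1 w_gt0 dTE dT_gt0.
  rewrite /midpoint_bound ltr_pdivlMr ?sqr_gt1 //.
  by apply: midpoint_stable => //; exact: ltnW.
- move=> w dT dt w_gt0 dTE dT_gt0; split.
    by apply: midpoint_stable => //; rewrite expr1n subrr mulr0; lra.
  by move: dTE; rewrite mul1r => ->; exact: midpoint_step1E.
- apply: inf_of_cvg => //; first exact: nbhs_infty_ge.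
  by move=> p p_gt1; rewrite /midpoint_bound ler_pdivlMr ?sqr_gt1 //; lra.
Qed.
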